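(* Let $\alpha\in(0,1)$ and $p\in[0,1]$, and let $(X_t)_{t\in\mathbb{N}_0}$ be the Antlion Random Walk with parameters $\alpha$ and $p$ started at $X_0=0$. Then for every integer $t\ge 1$, the expected value and the variance of $X_t$ are $$\mathbb{E}[X_t]=\frac{(1-2p)(1-\alpha^t)}{1-\alpha},\qquad \operatorname{Var}[X_t]=\frac{4p(1-p)(1-\alpha^{2t})}{1-\alpha^2}.$$
   Context: $\mathbb{N}=\{1,2,3,\dots\}$ and $\mathbb{N}_0=\mathbb{N}\cup\{0\}$. Let $(\xi_t)_{t\in\mathbb{N}}$ be independent, identically distributed random variables with $\mathbb{P}(\xi_t=-1)=p$ and $\mathbb{P}(\xi_t=1)=1-p$. The Antlion Random Walk (ARW) with parameters $\alpha$ and $p$ is the real-valued process defined by $X_0=0$ and $X_t=\alpha X_{t-1}+\xi_t$ for $t\in\mathbb{N}$; equivalently $X_t=\sum_{s=1}^{t}\alpha^{t-s}\xi_s$. *)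

(* Defs.v *)
From HB Require Import structures.
From mathcomp Require Import all_boot all_order all_algebra finmap.
From mathcomp Require Import all_classical all_reals all_analysis.

Set Implicit Arguments.
Unset Strict Implicit.
Unset Printing Implicit Defensive.

Import Order.TTheory GRing.Theory Num.Theory.
Import numFieldNormedType.Exports.

Local Open Scope classical_set_scope.
Local Open Scope ring_scope.

(* Mutual independence of the subfamily of X indexed by D: the product rule
   holds for every finite set J of indices in D and all measurable A i. *)
Definition independent_RVs (d d' : measure_display) (T : measurableType d)
    (T' : measurableType d') (R : realType) (P : probability T R)
    (I : choiceType) (D : set I) (X : I -> {RV P >-> T'}) : Prop :=
  forall (J : {fset I}) (A : I -> set T'),
    [set` J] `<=` D ->
    (forall i, i \in J -> measurable (A i)) ->
    P (\bigcap_(i in [set` J]) (X i @^-1` A i)) =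
      (\prod_(i <- J) P (X i @^-1` A i))%E.

Definition identically_distributed (d d' : measure_display)
    (T : measurableType d) (T' : measurableType d') (R : realType)
    (P : probability T R) (I : Type) (D : set I) (X : I -> {RV P >-> T'}) :
    Prop :=
  forall i j, D i -> D j ->
    forall A : set T', measurable A ->
      distribution P (X i) A = distribution P (X j) A.

(* The innovations are xi 1, xi 2, ...; the value xi 0 is never used. *)
Fixpoint antlion_walk (R : realType) (T : Type) (alpha : R)
    (xi : nat -> T -> R) (t : nat) : T -> R :=
  if t is s.+1 then fun w => alpha * antlion_walk alpha xi s w + xi s.+1 w
  else fun=> 0.

(* Main.v *)
(** Almost surely [xi i = 1 - 2 * \1_(xi i = -1)], so the walk is almost surely
    equal to one driven by bounded innovations, whose means and covariances are
    read off the probabilities of the events [xi i = -1].  Pairwise independence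
    makes [X t] and the next innovation uncorrelated; hence
    [m (t+1) = alpha * m t + (1 - 2p)] for the means and
    [v (t+1) = alpha^2 * v t + 4p(1 - p)] for the variances, two recurrences
    solved by geometric sums. *)
Require Import Defs.
From mathcomp Require Import all_boot all_order all_algebra finmap.
From mathcomp Require Import all_classical all_reals all_analysis.
From mathcomp Require Import measurable_realfun ring.

Set Implicit Arguments.
Unset Strict Implicit.
Unset Printing Implicit Defensive.

Import Order.TTheory GRing.Theory Num.Theory.
Import numFieldNormedType.Exports.

Local Open Scope classical_set_scope.
Local Open Scope ring_scope.

Section moments.
Context (d : measure_display) (T : measurableType d) (R : realType).
Variable P : probability T R.

Lemma expectation_ae (X Y : T -> R) :
  measurable_fun setT X -> measurable_fun setT Y ->
  {ae P, forall w, X w = Y w} -> 'E_P[X]%E = 'E_P[Y]%E.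
Proof.
move=> mX mY XY; rewrite unlock; apply: ae_eq_integral => //.
- exact/measurable_EFinP.
- exact/measurable_EFinP.
- by apply: filterS XY => w /= ->.
Qed.

(** The means coincide first, so both squared deviations are centred at the same constant and again
    agree almost surely. *)
Lemma variance_ae (X Y : T -> R) :
  measurable_fun setT X -> measurable_fun setT Y ->
  {ae P, forall w, X w = Y w} -> 'V_P[X]%E = 'V_P[Y]%E.
Proof.
move=> mX mY XY; rewrite /variance unlock.
rewrite (expectation_ae mX mY XY).
apply: expectation_ae.
- by apply: measurable_funM; apply: measurable_funB.
- by apply: measurable_funM; apply: measurable_funB.
- by apply: filterS XY => w /= XYw; rewrite !fctE /= XYw.
Qed.

Lemma bounded_Lfun2 (X : T -> R) (M : R) :
  measurable_fun setT X -> (forall w, `|X w| <= M) -> X \in Lfun P 2%:E.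
Proof.
move=> mX XM; rewrite inE; apply/andP; split; rewrite inE//=.
rewrite /finite_norm unlock poweR_lty//.
apply: (@le_lt_trans _ _ (\int[P]_w (cst (M `^ 2)%:E) w)%E).
  apply: ge0_le_integral => //.
  - by move=> w _; rewrite poweR_ge0.
  - apply/measurable_EFinP.
    apply/(@measurableT_comp _ _ _ _ _ _ (fun x : R => x `^ 2)%R) => //.
    exact/measurableT_comp.
  - move=> w _ /=; rewrite lee_fin ge0_ler_powR// nnegrE.
    exact: le_trans (XM w).
by rewrite integral_cst//= probability_setT mule1 ltry.
Qed.

Lemma indic_Lfun2 (A : set T) : measurable A ->
  (\1_A : T -> R) \in Lfun P 2%:E.
Proof.
move=> mA; apply: (@bounded_Lfun2 _ 1); first exact: measurable_indic.
by move=> w; rewrite indicE; case: (_ \in _); rewrite ?normr0 ?normr1.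
Qed.

Lemma covariance_indic (A B : set T) : measurable A -> measurable B ->
  covariance P \1_A \1_B = (P (A `&` B) - P A * P B)%E.
Proof.
move=> mA mB.
have Pfin : P setT \is a fin_num := fin_num_measure P _ measurableT.
rewrite covarianceE ?Lfun2_mul_Lfun1 ?(Lfun_subset12 Pfin) ?indic_Lfun2//.
rewrite !expectation_indic//.
have -> : (\1_A * \1_B)%R = \1_(A `&` B) :> (T -> R) by rewrite indicI.
by rewrite expectation_indic//; exact: measurableI.
Qed.

Section walk.
Variables (alpha : R) (eta : nat -> T -> R).

(** Puts the recursion in the form that the linearity lemmas expect; [\o*] multiplies on the right,
    whence the commutation. *)
Lemma antlion_walkS t :
  antlion_walk alpha eta t.+1 =
  alpha \o* antlion_walk alpha eta t \+ eta t.+1 :> (T -> R).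
Proof. by apply/funext => w /=; rewrite mulrC. Qed.

Lemma measurable_antlion_walk t :
  (forall i, measurable_fun setT (eta i)) ->
  measurable_fun setT (antlion_walk alpha eta t).
Proof.
move=> meta; elim: t => [|t IH]; first exact: measurable_cst.
rewrite antlion_walkS; apply: measurable_funD => //.
by apply: measurable_funM.
Qed.

Hypothesis eta2 : forall i, eta i \in Lfun P 2%:E.

Lemma antlion_walk_Lfun2 t : antlion_walk alpha eta t \in Lfun P 2%:E.
Proof.
elim: t => [|t IH]; first exact: Lfun_cst.
by rewrite antlion_walkS rpredD ?lee1n//= Lfun_scale ?ler1n.
Qed.

Lemma expectation_antlion_walk (m : R) t : alpha < 1 ->
  (forall i, (0 < i)%N -> 'E_P[eta i]%E = m%:E) ->
  'E_P[antlion_walk alpha eta t]%E = (m * (1 - alpha ^+ t) / (1 - alpha))%:E.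
Proof.
move=> a1 Em; have Pfin : P setT \is a fin_num := fin_num_measure P _ measurableT.
have a0 : 1 - alpha != 0 by rewrite subr_eq0 gt_eqF.
elim: t => [|t IH].
  by rewrite expectation_cst expr0 subrr mulr0 mul0r.
have W1 := Lfun_subset12 Pfin (antlion_walk_Lfun2 t).
rewrite antlion_walkS expectationD ?Lfun_scale //; last exact: Lfun_subset12.
rewrite expectationZl// IH Em// -EFinM -EFinD; congr EFin.
by rewrite exprS; field.
Qed.

(** By linearity in the first argument: the walk at time [t] combines only innovations of positive
    index at most [t], all below [j]. *)
Lemma covariance_antlion_walk t j :
  (forall i, (0 < i < j)%N -> covariance P (eta i) (eta j) = 0%E) ->
  (t < j)%N -> covariance P (antlion_walk alpha eta t) (eta j) = 0%E.
Proof.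
move=> cov0; have Pfin : P setT \is a fin_num := fin_num_measure P _ measurableT.
elim: t => [|t IH] tj; first exact: covariance_cst_l.
have W2 := antlion_walk_Lfun2 t.
rewrite antlion_walkS covarianceDl ?Lfun_scale ?ler1n//.
rewrite covarianceZl ?Lfun2_mul_Lfun1 ?(Lfun_subset12 Pfin)//.
by rewrite IH ?(ltnW tj)// cov0// mule0 adde0.
Qed.

Lemma variance_antlion_walk (v : R) t : 0 < alpha < 1 ->
  (forall i, (0 < i)%N -> 'V_P[eta i]%E = v%:E) ->
  (forall i j, (0 < i < j)%N -> covariance P (eta i) (eta j) = 0%E) ->
  'V_P[antlion_walk alpha eta t]%E =
    (v * (1 - alpha ^+ (2 * t)) / (1 - alpha ^+ 2))%:E.
Proof.
move=> /andP[a_gt0 a1] Vv cov0.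
have a0 : 1 - alpha ^+ 2 != 0 by rewrite subr_eq0 gt_eqF// expr_lt1// ltW.
elim: t => [|t IH].
  by rewrite variance_cst muln0 expr0 subrr mulr0 mul0r.
have W2 := antlion_walk_Lfun2 t.
rewrite antlion_walkS varianceD ?Lfun_scale ?ler1n//.
have Pfin : P setT \is a fin_num := fin_num_measure P _ measurableT.
rewrite covarianceZl ?Lfun2_mul_Lfun1 ?(Lfun_subset12 Pfin)//.
rewrite covariance_antlion_walk//; last by move=> i; exact: cov0.
rewrite !mule0 adde0 varianceZ// IH Vv// -EFinM -EFinD; congr EFin.
(* Up to the factor [v / (1 - alpha ^+ 2)], this is [alpha ^+ 2 * (1 - alpha ^+ (2 * t)) + (1 -
   alpha ^+ 2) = 1 - alpha ^+ (2 * t + 2)]. *)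
by rewrite mulnS exprD; field.
Qed.

End walk.

(** Only [eta 1], ..., [eta t] enter the walk at time [t], so finitely many exceptional null sets
    are united. *)
Lemma antlion_walk_ae (alpha : R) (eta zeta : nat -> T -> R) t :
  (forall i, (0 < i)%N -> {ae P, forall w, eta i w = zeta i w}) ->
  {ae P, forall w, antlion_walk alpha eta t w = antlion_walk alpha zeta t w}.
Proof.
move=> ez; elim: t => [|t IH]; first exact: aeW.
by apply: filterS2 IH (ez t.+1 isT) => w /= -> ->.
Qed.

(** The two level sets are disjoint and their probabilities add up to 1, so the complement of their
    union is null. *)
Lemma two_valued_ae (X : {RV P >-> R}) (a b p : R) : a != b ->
  P [set w | X w = a] = p%:E -> P [set w | X w = b] = (1 - p)%:E ->
  {ae P, forall w, X w = a \/ X w = b}.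
Proof.
move=> ab Pa Pb.
have mX c : measurable [set w | X w = c].
  exact: (measurable_funPTI X (measurable_set1 c)).
exists (~` ([set w | X w = a] `|` [set w | X w = b])); split => //.
- by apply: measurableC; exact: measurableU.
- rewrite probability_setC; last exact: measurableU.
  rewrite measureU//; last first.
    by apply/seteqP; split => // w [/= ->] /eqP; rewrite (negbTE ab).
  apply: (etrans (congr2 (fun x y => 1 - (x + y))%E Pa Pb)).
  by rewrite -EFinD addrC subrK subrr.
Qed.

Lemma independent_RVs_setI (I : choiceType) (D : set I) (X : I -> {RV P >-> R})
    (A B : set R) (i j : I) : independent_RVs D X -> D i -> D j -> i != j ->
  measurable A -> measurable B ->
  P (X i @^-1` A `&` X j @^-1` B) = (P (X i @^-1` A) * P (X j @^-1` B))%E.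
Proof.
move=> indep Di Dj ij mA mB.
(* The product rule on a two-element index set; [i != j] lets one family carry both [A] and [B] and
   keeps the two factors distinct. *)
have := indep [fset i; j]%fset (fun k => if k == i then A else B).
have -> : \bigcap_(k in [set` [fset i; j]%fset])
      (X k @^-1` (if k == i then A else B)) = X i @^-1` A `&` X j @^-1` B.
  apply/seteqP; split => [w h|w [wi wj] k /=].
    split; [have := h i|have := h j]; rewrite /= !inE eqxx ?orbT; first exact.
    by rewrite eq_sym (negbTE ij); exact.
  by rewrite !inE => /orP[/eqP->|/eqP->]; rewrite ?eqxx// eq_sym (negbTE ij).
move=> ->.
- by rewrite big_fsetU1/= ?big_seq_fset1 ?inE// eqxx eq_sym (negbTE ij).
- by move=> k; rewrite /= !inE => /orP[/eqP->|/eqP->].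
- by move=> k _; case: ifP.
Qed.

End moments.

Theorem proposition3p1 (R : realType) (d : measure_display)
    (T : measurableType d) (P : probability T R) (alpha p : R)
    (xi : nat -> {RV P >-> R})
    (alpha01 : 0 < alpha < 1) (p01 : 0 <= p <= 1)
    (xi_indep : independent_RVs [set t : nat | (1 <= t)%N] xi)
    (xi_id : identically_distributed [set t : nat | (1 <= t)%N] xi)
    (xi_m1 : forall t : nat, (1 <= t)%N -> P [set w | xi t w = -1] = p%:E)
    (xi_p1 : forall t : nat, (1 <= t)%N -> P [set w | xi t w = 1] = (1 - p)%:E)
    (t : nat) (t_ge1 : (1 <= t)%N) :
  let X := antlion_walk alpha xi in
  'E_P[X t]%E = ((1 - 2 * p) * (1 - alpha ^+ t) / (1 - alpha))%:E /\
  'V_P[X t]%E =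
    (4 * p * (1 - p) * (1 - alpha ^+ (2 * t)) / (1 - alpha ^+ 2))%:E.
Proof.
move=> X; pose A i := xi i @^-1` [set -1].
(* Equal to -1 on [A i] and to 1 off it, hence bounded and square-integrable for every [i],
   including 0. *)
pose eta i : T -> R := cst 1 \- 2 \o* \1_(A i).
have mA i : measurable (A i).
  exact: (measurable_funPTI (xi i) (measurable_set1 _)).
have PA i : (0 < i)%N -> P (A i) = p%:E by exact: xi_m1.
have Pfin : P setT \is a fin_num := fin_num_measure P _ measurableT.
have ind2 i : (\1_(A i) : T -> R) \in Lfun P 2%:E by exact: indic_Lfun2.
have ind1 i := Lfun_subset12 Pfin (ind2 i).
have sind2 i : 2 \o* \1_(A i) \in Lfun P 2%:E by rewrite Lfun_scale ?ler1n.
have eta2 i : eta i \in Lfun P 2%:E by rewrite rpredB ?lee1n//= Lfun_cst.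
have xi_eta i : (0 < i)%N -> {ae P, forall w, xi i w = eta i w}.
  move=> i0.
  have m1_neq1 : -1 != 1 :> R by rewrite eqNr oner_eq0.
  apply: filterS (two_valued_ae m1_neq1 (xi_m1 i i0) (xi_p1 i i0)) => w.
  rewrite /eta /= indicE; case=> xiw; rewrite xiw.
    by rewrite mem_set// mul1r; ring.
  rewrite memNset; first by rewrite mul0r subr0.
  by rewrite /A /= xiw => /esym/eqP; rewrite (negbTE m1_neq1).
have mxi i : measurable_fun setT (xi i) by exact: measurable_funPT.
have meta i : measurable_fun setT (eta i).
  by have := sub_Lfun_mfun (eta2 i); rewrite inE.
(* Constants have zero covariance with everything, and the two factors -2 multiply to the 4 of the
   variance formula. *)
have cov_eta i j : covariance P (eta i) (eta j) =
    (4%:E * covariance P \1_(A i) \1_(A j))%E.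
  rewrite covarianceBl ?Lfun_cst// covariance_cst_l add0e.
  rewrite covarianceBr ?Lfun_cst// covariance_cst_r add0e oppeK.
  have ind_sind1 := Lfun2_mul_Lfun1 (ind2 i) (sind2 j).
  have ind_ind1 := Lfun2_mul_Lfun1 (ind2 i) (ind2 j).
  rewrite covarianceZl ?(Lfun_subset12 Pfin (sind2 j))//.
  by rewrite covarianceZr// muleA -EFinM -natrM.
have mX := measurable_antlion_walk alpha t mxi.
have mY := measurable_antlion_walk alpha t meta.
have XY := antlion_walk_ae alpha t xi_eta.
have [alpha_gt0 alpha_lt1] := andP alpha01.
split.
  rewrite (expectation_ae mX mY XY).
  apply: expectation_antlion_walk => // i i0.
  rewrite expectationB ?Lfun_cst ?(Lfun_subset12 Pfin)//.
  rewrite expectation_cst expectationZl// expectation_indic// PA//.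
rewrite (variance_ae mX mY XY).
apply: variance_antlion_walk => // [i i0|i j /andP[i0 ij]].
  (* The diagonal case: [A i] meets itself in [A i], which gives [4 * (p - p * p)]. *)
  rewrite /variance cov_eta covariance_indic// setIid PA// -!EFinM.
  by congr EFin; ring.
have j0 : (0 < j)%N := ltn_trans i0 ij.
rewrite cov_eta covariance_indic//.
(* Both events are preimages of [[set -1]] under distinct innovations, so the probability of the
   intersection factors and the difference cancels. *)
rewrite (independent_RVs_setI xi_indep)// ?ltn_eqF//.
by rewrite PA// PA// subee// mule0.
Qed.
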